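(* Consider the single energy arrival problem and let $$E_{critical}=\frac{T_\delta b}{a}\,\frac{De^{bD}}{e^{bD}-1}.$$ If $E\le E_{critical}$, then the constant policy $P(t)=\frac ED$, $t\in[0,D]$, is optimal. Moreover $E_{critical}$ is the maximum energy level for which a constant power policy is optimal: if $E>E_{critical}$, no constant policy is optimal. Equivalently in terms of the critical temperature, for fixed $E$ and $T_e$, the policy $P(t)=\frac ED$ is optimal whenever $T_c>T_c^{limit}$, where $$T_c^{limit}=T_e+\frac ab\,\frac ED\,\frac{e^{bD}-1}{e^{bD}}.$$
   Context: Single energy arrival problem: fix a deadline $D>0$, an available energy $E>0$, constants $a,b>0$, an environment temperature $T_e$ and a critical temperature $T_c>T_e$; set $T_\delta=T_c-T_e$. A power policy is a measurable function $P:[0,D]\to[0,\infty)$. The resulting temperature $T(t)$ solves $\frac{d}{dt}T(t)=aP(t)-b(T(t)-T_e)$, $T(0)=T_e$, i.e. $T(t)=T_e+e^{-bt}\int_0^t ae^{b\tau}P(\tau)\,d\tau$. The optimal policy is the maximizer (unique almost everywhere) of $\int_0^D\frac12\log_2(1+P(\tau))\,d\tau$ over power policies satisfying $T(t)\le T_c$ for all $t\in[0,D]$ and $\int_0^DP(\tau)\,d\tau\le E$. *)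

(* Defs.v *)
From mathcomp Require Import all_boot all_order all_algebra.
From mathcomp Require Import all_classical all_reals all_analysis.
Set Implicit Arguments.
Unset Strict Implicit.
Unset Printing Implicit Defensive.
Import Order.TTheory GRing.Theory Num.Theory.
Import numFieldNormedType.Exports.
Local Open Scope classical_set_scope.
Local Open Scope ring_scope.

Definition log2 {R : realType} (x : R) : R := ln x / ln 2.

(* A policy on [0, D] is a total function R -> R whose values outside [0, D]
   are irrelevant: every notion below only looks at P on [0, D]. *)
Definition power_policy {R : realType} (D : R) (P : R -> R) : Prop :=
  measurable_fun `[0, D] P /\ (forall t, 0 <= t <= D -> 0 <= P t).

(* The solution of T' = a P - b (T - Te), T(0) = Te, in integrated form.
   Integrals are extended-real valued, so a policy that is not integrable has
   infinite temperature and infinite energy instead of a default value. *)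
Definition temperature {R : realType} (a b Te : R) (P : R -> R) (t : R)
    : \bar R :=
  (Te%:E + (expR (- (b * t)))%:E *
     \int[lebesgue_measure]_(tau in `[0%R, t])
        (a * expR (b * tau) * P tau)%:E)%E.

Definition energy {R : realType} (D : R) (P : R -> R) : \bar R :=
  (\int[lebesgue_measure]_(tau in `[0%R, D]) (P tau)%:E)%E.

Definition throughput {R : realType} (D : R) (P : R -> R) : \bar R :=
  (\int[lebesgue_measure]_(tau in `[0%R, D]) (2^-1 * log2 (1 + P tau))%:E)%E.

Definition feasible {R : realType} (D E a b Te Tc : R) (P : R -> R) : Prop :=
  [/\ power_policy D P,
      forall t, 0 <= t <= D -> (temperature a b Te P t <= Tc%:E)%E
    & (energy D P <= E%:E)%E].

Definition optimal {R : realType} (D E a b Te Tc : R) (P : R -> R) : Prop :=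
  feasible D E a b Te Tc P /\
  (forall Q, feasible D E a b Te Tc Q -> (throughput D Q <= throughput D P)%E).

Definition constant_policy {R : realType} (D : R) (P : R -> R) : Prop :=
  exists c, forall t, 0 <= t <= D -> P t = c.

Definition constant_optimal_energies {R : realType} (D a b Te Tc : R) : set R :=
  [set E | 0 < E /\ exists P, constant_policy D P /\ optimal D E a b Te Tc P].

Definition E_critical {R : realType} (D a b Te Tc : R) : R :=
  (Tc - Te) * b / a * (D * expR (b * D) / (expR (b * D) - 1)).

Definition Tc_limit {R : realType} (D E a b Te : R) : R :=
  Te + a / b * (E / D) * ((expR (b * D) - 1) / expR (b * D)).

(* Main.v *)
Require Import Defs.
From mathcomp Require Import all_boot all_order all_algebra.
From mathcomp Require Import all_classical all_reals all_analysis.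
From mathcomp Require Import measurable_realfun ring lra.
Set Implicit Arguments.
Unset Strict Implicit.
Unset Printing Implicit Defensive.
Import Order.TTheory GRing.Theory Num.Theory.
Import numFieldNormedType.Exports.
Local Open Scope classical_set_scope.
Local Open Scope ring_scope.

(* A constant policy is feasible for the temperature constraint iff its level is at most
   c = E_critical / D, and it beats every policy of the same energy because the concave throughput
   lies below its tangent. If E > E_critical, the policy c + e exp(-b t) (D/2 - t) is feasible for
   small e > 0: it only raises the temperature by a multiple of e exp(-b t) t (D - t), which vanishes
   at the deadline, where the constant policy reaches Tc. It spends slightly more energy than
   the constant c, and has a larger throughput: the first-order gain in e is positive because
   exp(-b t) gives more weight to the first half of [0, D]. *)

(** * Integration on [[0, t]] by primitives *)

Lemma integral_antiderivative (R : realType) (f F : R -> R) (t : R) : 0 <= t -> continuous f ->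
    (forall x : R, is_derive x 1 F (f x)) ->
  (\int[lebesgue_measure]_(x in `[0%R, t]) (f x)%:E = (F t - F 0)%:E)%E.
Proof.
(* The fundamental theorem asks for a nondegenerate interval, so [t = 0] is treated apart. *)
move=> t0 cf dF; have [<-|t0'] := eqVneq 0 t.
  by rewrite set_itv1 integral_set1 subrr.
have cF : continuous F.
  move=> x; apply: differentiable_continuous.
  by apply/derivable1_diffP; case: (dF x).
rewrite (@continuous_FTC2 _ f F)//.
- by rewrite lt_neqAle t0' t0.
- exact: continuous_subspaceT.
- split.
  + by move=> x _; have [] := dF x.
  + apply: cvg_at_right_filter; exact: cF.
  + apply: cvg_at_left_filter; exact: cF.
- by move=> x _; rewrite derive1E; have [] := dF x.
Qed.

Lemma integral_itv_cst (R : realType) (k t : R) : 0 <= t ->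
  (\int[lebesgue_measure]_(x in `[0%R, t]) k%:E = (k * t)%:E)%E.
Proof.
move=> t0; transitivity ((k * t - k * 0)%:E); last by rewrite mulr0 subr0.
apply: (@integral_antiderivative _ (cst k) (fun x => k * x)) => // x.
- exact: cst_continuous.
- by apply: is_derive_eq; rewrite /GRing.scale /= !mulr1.
Qed.

(** * Pointwise inequalities for [ln] and [expR] *)

Lemma ln_le_tangent (R : realType) (x y : R) : 0 < x -> 0 < y ->
  ln y <= ln x + (y - x) / x.
Proof.
move=> x0 y0; rewrite -lerBlDl -ln_div ?posrE//.
have -> : y / x = 1 + (y - x) / x by field; rewrite gt_eqF.
rewrite le_ln1Dx//; have : 0 < y / x by rewrite divr_gt0.
have -> : (y - x) / x = y / x - 1 by field; rewrite gt_eqF.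
by lra.
Qed.

(** The tangent at [1 + (c + h)], read at [1 + c], gives an increment of at least
    [h / (1 + (c + h))]. Against [(h - h ^+ 2) / (1 + c)], cross-multiplication leaves the
    difference [h ^+ 2 * (c + h)]. *)
Lemma ln_ge_quadratic (R : realType) (c h : R) : 0 <= c -> 0 <= c + h ->
  ln (1 + c) + (h - h ^+ 2) / (1 + c) <= ln (1 + (c + h)).
Proof.
move=> c0 ch0.
have w0 : 0 < 1 + c by lra.
have wh0 : 0 < 1 + (c + h) by lra.
have := ln_le_tangent wh0 w0.
rewrite (_ : 1 + c - (1 + (c + h)) = - h) ?mulNr; last by ring.
suff : (h - h ^+ 2) / (1 + c) <= h / (1 + (c + h)) by lra.
rewrite ler_pdivrMr// mulrAC ler_pdivlMr//.
have : 0 <= h ^+ 2 * (c + h) by rewrite mulr_ge0// sqr_ge0.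
by nra.
Qed.

(** An exponential weight favours [u > 0] over [u < 0], by a quadratic margin uniform on [[- d, d]].
    For [u >= 0] this is [expR (b * u) >= 1 + b * u]. For [u < 0], [expR (b * u) * (1 - b * u) <= 1]
    bounds [1 - expR (b * u)] below by [expR (- (b * d)) * (- (b * u))], and this is multiplied by
    [- u]. *)
Lemma mul_expR_ge (R : realType) (b d u : R) : 0 <= b -> - d <= u -> u <= d ->
  u + b * expR (- (b * d)) * u ^+ 2 <= expR (b * u) * u.
Proof.
move=> b0 du ud.
have bu2 : 0 <= b * u ^+ 2 by rewrite mulr_ge0// sqr_ge0.
have [u0|u0] := leP 0 u.
  have e1 : expR (- (b * d)) <= 1 by rewrite -expR0 ler_expR; nra.
  have : (1 + b * u) * u <= expR (b * u) * u.
    by rewrite ler_wpM2r// expR_ge1Dx.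
  by nra.
have e1 : expR (- (b * d)) <= expR (b * u) by rewrite ler_expR; nra.
have e2 : expR (b * u) * (1 - b * u) <= 1.
  rewrite -[leRHS](expR0 R) -(subrr (b * u)) expRD ler_wpM2l ?expR_ge0//.
  by rewrite expR_ge1Dx.
have e3 : expR (- (b * d)) * (- (b * u)) <= 1 - expR (b * u).
  apply: (@le_trans _ _ (expR (b * u) * (- (b * u)))); last by lra.
  by rewrite ler_wpM2r//; nra.
have : 0 <= (1 - expR (b * u) - expR (- (b * d)) * (- (b * u))) * (- u).
  by rewrite mulr_ge0//; lra.
by lra.
Qed.

(** * The perturbed policy and its temperature *)

(* The factor [expR (- (b * x))] cancels the weight of the temperature integral, leaving a
   primitive proportional to [x * (D - x)]. *)
Definition cooling_policy {R : realType} (b D c e x : R) : R :=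
  c + e * (expR (- (b * x)) * (D / 2 - x)).

Lemma continuous_cooling (R : realType) (b D c e : R) :
  continuous (cooling_policy b D c e).
Proof.
move=> x; apply: differentiable_continuous; apply/derivable1_diffP.
by rewrite /cooling_policy; exact: ex_derive.
Qed.

Lemma temperature_cooling (R : realType) (a b Te D c e t : R) : b != 0 -> 0 <= t ->
  temperature a b Te (cooling_policy b D c e) t =
  (Te + a * c / b * (1 - expR (- (b * t))) +
     a * e * expR (- (b * t)) * (t * (D - t) / 2))%:E.
Proof.
move=> b0 t0; rewrite /temperature.
pose F x := a * c / b * expR (b * x) + a * e / 2 * (x * (D - x)).
rewrite (_ : integral _ _ _ = (F t - F 0)%:E); last first.
  apply: (@integral_antiderivative _
    (fun x => a * expR (b * x) * cooling_policy b D c e x) F) => // x.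
    apply: differentiable_continuous; apply/derivable1_diffP.
    rewrite /cooling_policy.
    exact: ex_derive.
  rewrite /F; apply: is_derive_eq; rewrite /cooling_policy /GRing.scale /=.
  (* [field] sees the two exponentials as independent atoms, so the difference of the two sides is
     exhibited as a multiple of [1 - X * Y]. *)
  have := expRxMexpNx_1 (b * x); set X := expR (b * x); set Y := expR _ => XY.
  apply/eqP; rewrite -subr_eq0; apply/eqP.
  transitivity (a * e * (D / 2 - x) * (1 - X * Y)); last by rewrite XY subrr mulr0.
  by field.
rewrite /F -EFinM -EFinD; congr EFin.
rewrite mulr0 expR0 !mul0r mulr0 addr0 mulr1.
have := expRxMexpNx_1 (b * t); set X := expR (b * t); set Y := expR _ => XY.
apply/eqP; rewrite -subr_eq0; apply/eqP.
transitivity (a * c / b * (X * Y - 1)); last by rewrite XY subrr mulr0.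
by field.
Qed.

(** * Constant policies maximize throughput at given energy *)

Lemma measurable_throughput (R : realType) (D : R) (P : R -> R) :
  measurable_fun `[0, D] P ->
  measurable_fun `[0, D] (fun x => (2^-1 * log2 (1 + P x))%:E).
Proof.
move=> mP; apply/measurable_EFinP; rewrite /log2.
apply: measurable_funM; first exact: measurable_cst.
apply: measurable_funM; last exact: measurable_cst.
by apply: measurableT_comp => //; exact: measurable_funD.
Qed.

Lemma half_log2_ge0 (R : realType) (q : R) : 0 <= q -> 0 <= 2^-1 * log2 (1 + q).
Proof. by move=> q0; rewrite mulr_ge0 ?invr_ge0// divr_ge0// ln_ge0//; lra. Qed.

Lemma throughput_le_cst (R : realType) (D c : R) (Q : R -> R) :
    0 <= D -> 0 <= c -> power_policy D Q -> (energy D Q <= (c * D)%:E)%E ->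
  (throughput D Q <= (2^-1 * log2 (1 + c) * D)%:E)%E.
Proof.
move=> D0 c0 [mQ Q0] EQ.
have ln2 : 0 < ln 2 :> R by rewrite ln_gt0//; lra.
have c1 : 0 < 1 + c by lra.
(* The slope at [c] of the throughput density. *)
pose k : R := (2 * ln 2 * (1 + c))^-1.
have k0 : 0 <= k by rewrite invr_ge0 !mulr_ge0// ltW.
have Qge0 x : `[0, D]%classic x -> 0 <= Q x.
  by rewrite /= in_itv/= => /Q0.
have mcst (r : R) : measurable_fun `[0, D] (fun=> r%:E) by exact: measurable_cst.
have mkQ : measurable_fun `[0, D] (fun x => (k * Q x)%:E).
  by apply/measurable_EFinP; apply: measurable_funM => //; exact: measurable_cst.
(* Adding [c * k] moves the negative part of the tangent to the left, so that both integrands are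
   nonnegative and measurability suffices to compare and split the integrals. *)
rewrite -(@leeD2rE _ (c * k * D)%:E)//.
rewrite -(integral_itv_cst (c * k) D0) /throughput -ge0_integralD//; last 3 first.
- by move=> x xD; rewrite lee_fin half_log2_ge0 ?Qge0.
- exact: measurable_throughput.
- by move=> x xD; rewrite lee_fin mulr_ge0.
apply: (@le_trans _ _ (\int[lebesgue_measure]_(x in `[0%R, D])
    ((2^-1 * log2 (1 + c))%:E + (k * Q x)%:E))%E).
  apply: ge0_le_integral => //.
  - move=> x xD; rewrite -EFinD lee_fin addr_ge0 ?half_log2_ge0 ?Qge0//.
    exact: mulr_ge0.
  - exact: (emeasurable_funD (measurable_throughput mQ) (mcst _)).
  - exact: (emeasurable_funD (mcst _) mkQ).
  move=> x xD; rewrite -!EFinD lee_fin.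
  have Qx : 0 < 1 + Q x by have := Qge0 _ xD; lra.
  have -> : 2^-1 * log2 (1 + Q x) = 2^-1 / ln 2 * ln (1 + Q x) by rewrite /log2; ring.
  have -> : 2^-1 * log2 (1 + c) + k * Q x =
      2^-1 / ln 2 * (ln (1 + c) + (1 + Q x - (1 + c)) / (1 + c)) + c * k.
    by rewrite /log2 /k; field; rewrite !gt_eqF.
  by rewrite lerD2r ler_pM2l ?divr_gt0//; exact: ln_le_tangent.
rewrite ge0_integralD//; last 2 first.
- by move=> x xD; rewrite lee_fin half_log2_ge0.
- by move=> x xD; rewrite lee_fin mulr_ge0// Qge0.
rewrite !integral_itv_cst// leeD2l//.
under eq_integral do rewrite EFinM.
rewrite ge0_integralZl_EFin//; last first.
  exact/measurable_EFinP.
apply: (@le_trans _ _ (k%:E * (c * D)%:E)%E); first by rewrite lee_wpmul2l.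
by rewrite -EFinM lee_fin mulrCA mulrA.
Qed.

Lemma throughput_cst (R : realType) (D c : R) (P : R -> R) : 0 <= D ->
  (forall t, 0 <= t <= D -> P t = c) ->
  throughput D P = (2^-1 * log2 (1 + c) * D)%:E.
Proof.
move=> D0 Pc; rewrite /throughput -integral_itv_cst//.
by apply: eq_integral => x; rewrite inE/= in_itv/= => /Pc ->.
Qed.

Lemma energy_cst (R : realType) (D c : R) (P : R -> R) : 0 <= D ->
  (forall t, 0 <= t <= D -> P t = c) -> energy D P = (c * D)%:E.
Proof.
move=> D0 Pc; rewrite /energy -integral_itv_cst//.
by apply: eq_integral => x; rewrite inE/= in_itv/= => /Pc ->.
Qed.

(** * Constant policies and the critical energy *)

Lemma temperature_cst (R : realType) (a b Te D c t : R) (P : R -> R) :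
  b != 0 -> 0 <= t <= D -> (forall t, 0 <= t <= D -> P t = c) ->
  temperature a b Te P t = (Te + a * c / b * (1 - expR (- (b * t))))%:E.
Proof.
move=> b0 /andP[t0 tD] Pc.
(* A constant is the cooling policy with [e = 0]. *)
have := temperature_cooling a Te 0 c 0 b0 t0.
rewrite mulr0 !mul0r addr0 => <-; rewrite /temperature; congr (_ + _ * _)%E.
apply: eq_integral => x; rewrite inE/= in_itv/= => /andP[x0 xt].
by rewrite /cooling_policy mul0r addr0 Pc// x0 (le_trans xt).
Qed.

(* The constant policy of level [E_critical / D] reaches [Tc] exactly at the deadline. *)
Lemma E_criticalE (R : realType) (D a b Te Tc : R) : 0 < D -> 0 < a -> 0 < b ->
  a * (E_critical D a b Te Tc / D) / b * (1 - expR (- (b * D))) = Tc - Te.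
Proof.
move=> D0 a0 b0; rewrite expRN /E_critical.
have X1 : 1 < expR (b * D) by rewrite expR_gt1 mulr_gt0.
by field; rewrite ?gt_eqF ?subr_gt0 ?expR_gt0.
Qed.

Lemma E_critical_gt0 (R : realType) (D a b Te Tc : R) : 0 < D -> 0 < a -> 0 < b ->
  Te < Tc -> 0 < E_critical D a b Te Tc.
Proof.
move=> D0 a0 b0 TT; rewrite /E_critical.
have X1 : 1 < expR (b * D) by rewrite expR_gt1 mulr_gt0.
apply: mulr_gt0; apply: divr_gt0 => //; last by rewrite subr_gt0.
  by apply: mulr_gt0; rewrite ?subr_gt0.
by apply: mulr_gt0 => //; exact: expR_gt0.
Qed.

(** Under constant power the temperature increases with time and with the level, so the worst case
    is the deadline at level [E_critical / D], where it equals [Tc]. *)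
Lemma cst_feasible (R : realType) (D E a b Te Tc c : R) :
    0 < D -> 0 < a -> 0 < b -> 0 <= c -> c * D <= E ->
    c * D <= E_critical D a b Te Tc ->
  feasible D E a b Te Tc (fun=> c).
Proof.
move=> D0 a0 b0 c0 cE cEc; split.
- by split => //; exact: measurable_cst.
- move=> t tD; rewrite (@temperature_cst _ _ _ _ D c)// ?gt_eqF// lee_fin.
  rewrite -lerBrDl -(E_criticalE Te Tc D0 a0 b0).
  have cc : a * c / b <= a * (E_critical D a b Te Tc / D) / b.
    by rewrite ler_pM2r ?invr_gt0// ler_pM2l// ler_pdivlMr.
  apply: ler_pM => //; first by rewrite divr_ge0 ?mulr_ge0// ltW.
    by rewrite subr_ge0 -expR0 ler_expR oppr_le0 mulr_ge0 ?(ltW b0)//; case/andP: tD.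
  rewrite lerD2l lerN2 ler_expR lerN2 ler_pM2l//; by case/andP: tD.
- by rewrite (@energy_cst _ _ c)// ?lee_fin ?ltW.
Qed.

Lemma feasible_cst_le (R : realType) (D E a b Te Tc c : R) (P : R -> R) :
    0 < D -> 0 < a -> 0 < b -> (forall t, 0 <= t <= D -> P t = c) ->
    feasible D E a b Te Tc P ->
  0 <= c /\ c * D <= E_critical D a b Te Tc.
Proof.
move=> D0 a0 b0 Pc [[_ P0] TP _].
have DD : 0 <= D <= D by rewrite lexx ltW.
split; first by rewrite -(Pc _ DD) P0.
have := TP _ DD; rewrite (@temperature_cst _ _ _ _ D c)// ?gt_eqF// lee_fin.
rewrite -lerBrDl -(E_criticalE Te Tc D0 a0 b0).
by rewrite !ler_pM2r ?invr_gt0 ?subr_gt0 ?expR_lt1 ?oppr_lt0 ?mulr_gt0//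
   ler_pM2l// ler_pdivlMr.
Qed.

Lemma cst_optimal (R : realType) (D E a b Te Tc : R) :
    0 < D -> 0 < E -> 0 < a -> 0 < b -> E <= E_critical D a b Te Tc ->
  optimal D E a b Te Tc (fun=> E / D).
Proof.
move=> D0 E0 a0 b0 EEc; have ED : E / D * D = E by field; rewrite gt_eqF.
have ED0 : 0 <= E / D by rewrite divr_ge0 ?ltW.
split; first by apply: cst_feasible; rewrite ?ED.
move=> Q [pQ _ EQ]; rewrite (@throughput_cst _ D (E / D) (fun=> E / D)) ?(ltW D0)//.
by apply: throughput_le_cst; rewrite ?ED ?(ltW D0).
Qed.

Lemma le_E_critical (R : realType) (D E a b Te Tc : R) :
    0 < D -> 0 < a -> 0 < b ->
  E <= E_critical D a b Te Tc <-> Tc_limit D E a b Te <= Tc.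
Proof.
move=> D0 a0 b0; rewrite /E_critical /Tc_limit.
have X1 : 1 < expR (b * D) by rewrite expR_gt1 mulr_gt0.
set X := expR _ in X1 *; have X0 : 0 < X by lra.
have Y0 : 0 < X - 1 by lra.
(* The temperature rise at the deadline per unit of energy spent at constant power. *)
pose k := a / b / D * ((X - 1) / X).
have k0 : 0 < k by rewrite !(mulr_gt0, invr_gt0).
rewrite -lerBrDl -[E <= _](ler_pM2l k0).
have -> : k * ((Tc - Te) * b / a * (D * X / (X - 1))) = Tc - Te.
  by rewrite /k; field; rewrite !gt_eqF.
by have -> : k * E = a / b * (E / D) * ((X - 1) / X) by rewrite /k; ring.
Qed.

(** * Throughput gain and feasibility of the perturbed policy *)

(* With [u = D / 2 - t], the throughput density of [cooling_policy] dominates a quadratic polynomial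
   in [u] whose linear term integrates to 0 and whose [u ^ 2] coefficient is positive for small [e]. *)
Lemma ln_cooling_ge (R : realType) (b D c e t : R) :
    0 <= b -> 0 <= c -> 0 <= e -> 0 <= t <= D -> 0 <= cooling_policy b D c e t ->
  ln (1 + c) + e * expR (- (b * (D / 2))) / (1 + c) * (D / 2 - t) +
    e * (b * expR (- (b * (D / 2))) ^+ 2 - e) / (1 + c) * (D / 2 - t) ^+ 2
  <= ln (1 + cooling_policy b D c e t).
Proof.
move=> b0 c0 e0 /andP[t0 tD] Q0.
have w0 : 0 < 1 + c by lra.
apply: le_trans (ln_ge_quadratic c0 Q0); rewrite -addrA lerD2l.
set s := expR (- (b * (D / 2))); set Y := expR (- (b * t)).
set u := D / 2 - t.
have Y0 : 0 <= Y by exact: expR_ge0.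
have Y1 : Y <= 1 by rewrite -[leRHS](expR0 R) ler_expR oppr_le0 mulr_ge0.
(* Recentring time at [D / 2] puts the weight in the form of [mul_expR_ge] with [d = D / 2]. *)
have YE : Y = s * expR (b * u) by rewrite -expRD; congr expR; rewrite /u; ring.
have ud : - (D / 2) <= u <= D / 2 by rewrite /u; lra.
have /andP[ud1 ud2] := ud.
have Yu : s * (u + b * s * u ^+ 2) <= Y * u.
  by rewrite YE -[leRHS]mulrA ler_wpM2l ?expR_ge0//; exact: mul_expR_ge.
have Yu2 : (Y * u) ^+ 2 <= u ^+ 2.
  by rewrite exprMn ler_piMl ?sqr_ge0// expr_le1.
have -> : e * s / (1 + c) * u + e * (b * s ^+ 2 - e) / (1 + c) * u ^+ 2 =
    (e * (s * (u + b * s * u ^+ 2)) - e ^+ 2 * u ^+ 2) / (1 + c).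
  by field; rewrite gt_eqF.
rewrite ler_pM2r ?invr_gt0// lerD//; first by rewrite ler_wpM2l.
by rewrite lerN2 exprMn ler_wpM2l ?sqr_ge0.
Qed.

Lemma integral_centered_quadratic (R : realType) (D k0 k1 k2 : R) : 0 <= D ->
  (\int[lebesgue_measure]_(x in `[0%R, D])
     (k0 + k1 * (D / 2 - x) + k2 * (D / 2 - x) ^+ 2)%:E
   = (k0 * D + k2 * (D ^+ 3 / 12))%:E)%E.
Proof.
move=> D0.
pose F x := k0 * x + k1 / 2 * (x * (D - x)) - k2 / 3 * (D / 2 - x) ^+ 3.
transitivity ((F D - F 0)%:E); last by congr EFin; rewrite /F; field.
apply: (@integral_antiderivative _
  (fun x => k0 + k1 * (D / 2 - x) + k2 * (D / 2 - x) ^+ 2) F) => // x.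
  apply: differentiable_continuous; apply/derivable1_diffP.
  exact: ex_derive.
by rewrite /F; apply: is_derive_eq; rewrite /GRing.scale /=; field.
Qed.

Lemma throughput_cooling_gt (R : realType) (b D c e : R) :
    0 < D -> 0 < b -> 0 <= c -> 0 < e -> e < b * expR (- (b * (D / 2))) ^+ 2 ->
    (forall t, 0 <= t <= D -> 0 <= cooling_policy b D c e t) ->
  ((2^-1 * log2 (1 + c) * D)%:E < throughput D (cooling_policy b D c e))%E.
Proof.
move=> D0 b0 c0 e0 es Q0.
have ln2 : 0 < ln 2 :> R by rewrite ln_gt0//; lra.
have w0 : 0 < 1 + c by lra.
pose K : R := 2^-1 / ln 2; have K0 : 0 < K by rewrite divr_gt0.
pose s := expR (- (b * (D / 2))).
pose k1 := K * (e * s / (1 + c)).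
pose k2 := K * (e * (b * s ^+ 2 - e) / (1 + c)).
have k20 : 0 < k2 by rewrite mulr_gt0// divr_gt0// mulr_gt0// subr_gt0.
have log2E (x : R) : 2^-1 * log2 x = K * ln x by rewrite /log2 /K; ring.
apply: (@lt_le_trans _ _ (\int[lebesgue_measure]_(x in `[0%R, D])
    (2^-1 * log2 (1 + c) + k1 * (D / 2 - x) + k2 * (D / 2 - x) ^+ 2)%:E)%E).
  rewrite integral_centered_quadratic ?(ltW D0)// lte_fin ltrDl.
  by rewrite mulr_gt0// divr_gt0// exprn_gt0.
(* The quadratic bound may be negative, so monotonicity of the integral rests on integrability,
   which continuity on the compact [[0, D]] provides. *)
have cI (f : R -> R) : {in `[0, D]%classic, continuous f} ->
    lebesgue_measure.-integrable `[0, D] (EFin \o f).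
  move=> cf; apply: continuous_compact_integrable; first exact: segment_compact.
  exact: continuous_in_subspaceT.
apply: le_integral => //.
- apply: cI => x _; apply: differentiable_continuous; apply/derivable1_diffP.
  exact: ex_derive.
- apply: (cI (fun x => 2^-1 * log2 (1 + cooling_policy b D c e x))) => x.
  rewrite inE /= in_itv/= => /Q0 Qx0.
  have Qx1 : 0 < 1 + cooling_policy b D c e x by lra.
  apply: cvgM; first exact: cvg_cst.
  apply: cvgM; last exact: cvg_cst.
  apply: (@continuous_comp _ _ _ (fun y => 1 + cooling_policy b D c e y) (@ln R)).
    apply: cvgD; first exact: cvg_cst.
    exact: continuous_cooling.
  exact: continuous_ln.
- move=> x; rewrite inE /= in_itv/= => xD; rewrite lee_fin !log2E.
  have H := ln_cooling_ge (ltW b0) c0 (ltW e0) xD (Q0 _ xD).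
  rewrite -(ler_pM2l K0) in H; apply: le_trans H.
  by rewrite le_eqVlt; apply/predU1P; left; rewrite /k1 /k2 /s; ring.
Qed.

(** At time [t] the constant [c] leaves a temperature slack proportional to
    [1 - expR (- (b * (D - t)))]. Near the deadline it vanishes linearly in [D - t], as does the
    added heat, so a smallness condition on [e] suffices. The same condition keeps the power
    nonnegative. *)
Lemma cooling_feasible (R : realType) (D E a b Te Tc c e : R) :
    0 < D -> 0 < a -> 0 < b -> 0 <= e ->
    c * D = E_critical D a b Te Tc ->
    e * (D / 2) <= c * expR (- (b * D)) -> (c + e * (D / 2)) * D <= E ->
  feasible D E a b Te Tc (cooling_policy b D c e).
Proof.
move=> D0 a0 b0 e0 cE ec eE.
have Z0 : 0 < expR (- (b * D)) by exact: expR_gt0.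
have Z1 : expR (- (b * D)) <= 1.
  by rewrite -[leRHS](expR0 R) ler_expR oppr_le0 mulr_ge0// ltW.
have c0 : 0 <= c by rewrite -(pmulr_lge0 _ Z0) (le_trans _ ec)// mulr_ge0//; lra.
have hle t : 0 <= t <= D -> `|expR (- (b * t)) * (D / 2 - t)| <= D / 2.
  move=> /andP[t0 tD]; rewrite normrM -[leRHS]mul1r ler_pM//.
    rewrite ger0_norm ?expR_ge0// -[leRHS](expR0 R) ler_expR oppr_le0.
    by rewrite mulr_ge0// ltW.
  by rewrite ler_norml; lra.
have Qb t : 0 <= t <= D -> 0 <= cooling_policy b D c e t <= c + e * (D / 2).
  move=> /hle; rewrite ler_norml /cooling_policy => /andP[h1 h2].
  rewrite lerD2l ler_wpM2l// andbT.
  have : e * - (D / 2) <= e * (expR (- (b * t)) * (D / 2 - t)) by rewrite ler_wpM2l.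
  by nra.
have mQ : measurable_fun `[0, D] (cooling_policy b D c e).
  by apply: measurable_funTS; apply: continuous_measurable_fun; exact: continuous_cooling.
split.
- by split => // t /Qb /andP[].
- move=> t /andP[t0 tD].
  rewrite temperature_cooling ?gt_eqF// lee_fin -addrA -lerBrDl.
  rewrite -(E_criticalE Te Tc D0 a0 b0) -cE mulfK ?gt_eqF//.
  set Z := expR (- (b * D)) in Z0 Z1 ec *; set Y := expR (- (b * t)).
  (* With these, the slack is [a * c / b * Y * (1 - V)], and [1 - V >= V * x >= Z * x] is the linear
     lower bound. *)
  pose x := b * (D - t); pose V := expR (- x).
  have Y0 : 0 < Y by exact: expR_gt0.
  have x0 : 0 <= x by rewrite mulr_ge0 ?subr_ge0// ltW.
  have ZE : Z = Y * V by rewrite -expRD; congr expR; rewrite /x; ring.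
  have ZV : Z <= V by rewrite ZE ler_piMl ?expR_ge0// -[leRHS](expR0 R) ler_expR oppr_le0 mulr_ge0// ltW.
  have V1 : V * (1 + x) <= 1.
    rewrite -[leRHS](expRxMexpNx_1 x) mulrC ler_wpM2r ?expR_ge0//.
    exact: expR_ge1Dx.
  have xV : Z * x <= 1 - V by apply: (@le_trans _ _ (V * x)); [exact: ler_wpM2r|lra].
  have H1 : e * (D / 2) * x <= c * (1 - V).
    apply: (@le_trans _ _ (c * Z * x)); first exact: ler_wpM2r.
    by rewrite -mulrA ler_wpM2l.
  have H2 : e * (t / 2) * x <= e * (D / 2) * x.
    by rewrite ler_wpM2r// ler_wpM2l//; lra.
  have H : e * (t * (D - t) / 2) <= c / b * (1 - V).
    rewrite [leRHS]mulrAC ler_pdivlMr//; apply: le_trans H1; apply: le_trans H2.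
    by rewrite le_eqVlt; apply/predU1P; left; rewrite /x; field.
  rewrite ZE -subr_ge0.
  have -> : a * c / b * (1 - Y * V) - (a * c / b * (1 - Y) + a * e * Y * (t * (D - t) / 2))
      = a * Y * (c / b * (1 - V) - e * (t * (D - t) / 2)) by ring.
  by rewrite !mulr_ge0 ?subr_ge0// ltW.
(* The energy is bounded through the pointwise maximum of the power. *)
- apply: (@le_trans _ _ ((c + e * (D / 2)) * D)%:E); last by rewrite lee_fin.
  rewrite -integral_itv_cst ?(ltW D0)//; apply: ge0_le_integral => //.
  + by move=> x; rewrite /= in_itv/= => /Qb /andP[]; rewrite lee_fin.
  + exact/measurable_EFinP.
  + by move=> x; rewrite /= in_itv/= => /Qb /andP[]; rewrite lee_fin.
Qed.

(** * Above the critical energy, and conclusion *)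

Lemma cst_not_optimal (R : realType) (D E a b Te Tc : R) (P : R -> R) :
    0 < D -> 0 < a -> 0 < b -> Te < Tc -> E_critical D a b Te Tc < E ->
    constant_policy D P ->
  ~ optimal D E a b Te Tc P.
Proof.
move=> D0 a0 b0 TT EcE [p Pp] [fP oP].
have [p0 pE] := feasible_cst_le D0 a0 b0 Pp fP.
set Ec := E_critical D a b Te Tc in EcE pE; pose c := Ec / D.
have c0 : 0 < c by rewrite divr_gt0// E_critical_gt0.
have cD : c * D = Ec by rewrite /c; field; rewrite gt_eqF.
(* No feasible constant exceeds level [c], so a feasible policy strictly better than [c] refutes
   optimality of [P]. *)
have pc : p <= c by rewrite ler_pdivlMr.
have D20 : 0 < D / 2 by lra.
(* The three upper bounds on [e] serve, in order, the throughput gain, the temperature and sign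
   constraints, and the energy budget. *)
have [e [e0 e1 e2 e3]] : exists e : R, [/\ 0 < e,
    e < b * expR (- (b * (D / 2))) ^+ 2,
    e < c * expR (- (b * D)) / (D / 2) & e < (E - Ec) / (D / 2 * D)].
  near (0 : R)^'+ => e; exists e; split; near: e.
  - exact: nbhs_right_gt.
  - by apply: nbhs_right_lt; rewrite mulr_gt0// exprn_gt0// expR_gt0.
  - by apply: nbhs_right_lt; rewrite divr_gt0// mulr_gt0// expR_gt0.
  - by apply: nbhs_right_lt; rewrite divr_gt0 ?subr_gt0// mulr_gt0.
have fQ : feasible D E a b Te Tc (cooling_policy b D c e).
  apply: cooling_feasible => //; first exact: ltW.
    by rewrite -ler_pdivlMr ?ltW// divr_gt0.
  by move: e3; rewrite ltr_pdivlMr ?mulr_gt0// mulrDl cD; lra.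
have [[_ Q0] _ _] := fQ.
have := throughput_cooling_gt D0 b0 (ltW c0) e0 e1 Q0.
apply/negP; rewrite -leNgt (le_trans (oP _ fQ))// (throughput_cst (ltW D0) Pp).
have ln2 : 0 < ln 2 :> R by rewrite ln_gt0//; lra.
rewrite lee_fin ler_pM2r// ler_pM2l// ler_pM2r ?invr_gt0// ler_ln ?posrE; lra.
Unshelve. all: by end_near.
Qed.

Theorem mainTheorem7 (R : realType) (D E a b Te Tc : R)
    (D_gt0 : 0 < D) (E_gt0 : 0 < E) (a_gt0 : 0 < a) (b_gt0 : 0 < b)
    (Te_lt_Tc : Te < Tc) :
  [/\ E <= E_critical D a b Te Tc ->
        optimal D E a b Te Tc (fun _ => E / D),
      E_critical D a b Te Tc < E ->
        forall P : R -> R, constant_policy D P -> ~ optimal D E a b Te Tc P,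
      constant_optimal_energies D a b Te Tc (E_critical D a b Te Tc) /\
        ubound (constant_optimal_energies D a b Te Tc)
               (E_critical D a b Te Tc),
      E <= E_critical D a b Te Tc <-> Tc_limit D E a b Te <= Tc
    & Tc_limit D E a b Te < Tc ->
        optimal D E a b Te Tc (fun _ => E / D)].
Proof.
have Ec0 := E_critical_gt0 D_gt0 a_gt0 b_gt0 Te_lt_Tc.
split.
- exact: cst_optimal.
- by move=> EcE P; exact: cst_not_optimal.
- split.
    split=> //; exists (fun=> E_critical D a b Te Tc / D).
    by split; [exists (E_critical D a b Te Tc / D)|exact: cst_optimal].
  move=> E' [_ [P [cP oP]]]; rewrite leNgt; apply/negP => EcE'.
  exact: cst_not_optimal EcE' cP oP.
- exact: le_E_critical.
- by move=> /ltW/(le_E_critical E Te Tc D_gt0 a_gt0 b_gt0); exact: cst_optimal.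
Qed.
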